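(* Let $T$ be an $r$-interval exchange transformation with no periodic point, with discontinuities $\gamma_1,\dots,\gamma_{r-1}$, and let $\beta_1,\dots,\beta_{r-1}$ be the discontinuities of $T^{-1}$. Let $M$ be the largest integer $n\ge 0$ for which, for some $i$ and $j$, there is a primitive connection $T^n\beta_i=\gamma_j$, or $M=0$ if there is no such connection. Then $T$ is minimal if and only if the Rauzy graph $G_{M+1}$ of the language $L(T)$ defined by the natural coding of $T$ is connected (as a non-oriented graph).
   Context: Interval exchange: given $\lambda_1,\dots,\lambda_r>0$ with sum $1$ and a permutation $\pi$ of $\{1,\dots,r\}$, put $I_i=[\sum_{j<i}\lambda_j,\sum_{j\le i}\lambda_j[$ (semi-open intervals) and define $T$ on $[0,1[$ by $Tx=x+\sum_{\pi^{-1}(j)<\pi^{-1}(i)}\lambda_j-\sum_{j<i}\lambda_j$ for $x\in I_i$; thus the images are, from left to right, $TI_{\pi(1)},\dots,TI_{\pi(r)}$. For $1\le i\le r-1$, the $i$-th discontinuity of $T$ is $\gamma_i=\sum_{j\le i}\lambda_j$ and the $i$-th discontinuity of $T^{-1}$ is $\beta_i=\sum_{\pi^{-1}(j)\le i}\lambda_j$ (these points need not be actual discontinuities). Primitive connection of length $n\ge0$: an equality $T^n\beta_i=\gamma_j$ such that $T^p\beta_i\ne\gamma_k$ for every $k$ and every $0\le p<n$. Minimal: every orbit is dense in $[0,1[$. Natural coding: the trajectory of $x$ is the sequence $(x_n)_{n\ge0}$ with $x_n=i$ if $T^nx\in I_i$; $L(T)$ is the set of all finite factors (blocks of consecutive letters)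 of all trajectories. Rauzy graph: $G_n$ has as vertices all words of length $n$ of $L(T)$, with an edge from $w$ to $w'$ whenever $w=av$, $w'=vb$ for letters $a,b$ and the word $avb$ is in $L(T)$. *)

(* Defs.v *)
From HB Require Import structures.
From mathcomp Require Import all_boot all_order all_algebra all_fingroup.
From mathcomp Require Import boolp classical_sets set_interval reals.
From mathcomp Require Import topology normedtype.
Set Implicit Arguments.
Unset Strict Implicit.
Unset Printing Implicit Defensive.
Import Order.TTheory GRing.Theory Num.Theory.
Import numFieldNormedType.Exports.
Local Open Scope classical_set_scope.
Local Open Scope ring_scope.

(* Letters are numbered from 0: the intervals are indexed by 'I_r.  The        *)
(* discontinuities keep their indices 1, ..., r - 1, so that [disc lam i] and  *)
(* [disc_inv lam s i] are the sums of the first i lengths, in the order of the *)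
(* intervals and of their images respectively; [disc lam 0] = 0 and            *)
(* [disc lam r] = 1 are endpoints, not discontinuities.                        *)

Definition disc (R : realType) (r : nat) (lam : 'I_r -> R) (i : nat) : R :=
  \sum_(j < r | (j < i)%N) lam j.

Definition disc_inv (R : realType) (r : nat) (lam : 'I_r -> R) (s : 'S_r)
    (i : nat) : R :=
  \sum_(j < r | ((s^-1)%g j < i)%N) lam j.

Definition interv (R : realType) (r : nat) (lam : 'I_r -> R) (i : 'I_r) : set R :=
  [set x | disc lam i <= x < disc lam i.+1].

(* Only the values on [0, 1[ matter; the map is extended by the identity.      *)
Definition iet (R : realType) (r : nat) (lam : 'I_r -> R) (s : 'S_r) (x : R) : R :=
  if [pick i : 'I_r | disc lam i <= x < disc lam i.+1] is Some i then
    x + \sum_(j < r | ((s^-1)%g j < (s^-1)%g i)%N) lam j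
      - \sum_(j < r | (j < i)%N) lam j
  else x.

Definition no_periodic_point (R : realType) (T : R -> R) : Prop :=
  forall (x : R) (n : nat), `[0, 1[%classic x -> (0 < n)%N -> iter n T x <> x.

Definition orbit_of (R : realType) (T : R -> R) (x : R) : set R :=
  [set iter n T x | n in [set: nat]].

Definition minimal (R : realType) (T : R -> R) : Prop :=
  forall x : R, `[0, 1[%classic x -> `[0, 1[ `<=` closure (orbit_of T x).

Definition primitive_connection (R : realType) (r : nat) (lam : 'I_r -> R)
    (s : 'S_r) (n i j : nat) : Prop :=
  [/\ (0 < i < r)%N, (0 < j < r)%N,
      iter n (iet lam s) (disc_inv lam s i) = disc lam j &
      forall k p : nat, (0 < k < r)%N -> (p < n)%N ->
        iter p (iet lam s) (disc_inv lam s i) <> disc lam k].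

Definition connection_length (R : realType) (r : nat) (lam : 'I_r -> R)
    (s : 'S_r) : set nat :=
  [set n | exists i j : nat, primitive_connection lam s n i j].

(* The default value 0 of [xget] is taken only when there is no primitive      *)
(* connection: for a given i, at most one n starts a primitive connection at   *)
(* [disc_inv lam s i], so there are at most r - 1 lengths.                     *)
Definition max_connection (R : realType) (r : nat) (lam : 'I_r -> R)
    (s : 'S_r) : nat :=
  xget 0%N [set n | connection_length lam s n /\
    forall m : nat, connection_length lam s m -> (m <= n)%N].

Definition trajectory (R : realType) (r : nat) (lam : 'I_r -> R) (s : 'S_r)
    (x : R) (u : nat -> 'I_r) : Prop :=
  forall n : nat, interv lam (u n) (iter n (iet lam s) x).

Definition factor (A : Type) (w : seq A) (u : nat -> A) : Prop :=
  exists m : nat, w = mkseq (fun k => u (m + k)%N) (size w).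

Definition language (R : realType) (r : nat) (lam : 'I_r -> R) (s : 'S_r) :
    set (seq 'I_r) :=
  [set w | exists (x : R) (u : nat -> 'I_r),
    [/\ `[0, 1[%classic x, trajectory lam s x u & factor w u]].

Definition rauzy_edge (A : Type) (L : set (seq A)) (n : nat)
    (w w' : n.-tuple A) : Prop :=
  exists (a b : A) (v : seq A),
    [/\ w = a :: v :> seq A, w' = rcons v b :> seq A & L (a :: rcons v b)].

Definition rauzy_adj (A : finType) (L : set (seq A)) (n : nat) :
    rel (n.-tuple A) :=
  fun w w' => `[< rauzy_edge L w w' >] || `[< rauzy_edge L w' w >].

(* If L is closed under taking factors, both ends of an edge are in L, so a    *)
(* path of [rauzy_adj L] between two vertices does not leave the graph.        *)
Definition rauzy_connected (A : finType) (L : set (seq A)) (n : nat) : Prop :=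
  forall w w' : n.-tuple A, L w -> L w' -> connect (@rauzy_adj A L n) w w'.

(* Main.v *)
Require Import Defs.
From mathcomp Require Import all_boot all_order all_algebra all_fingroup.
From mathcomp Require Import boolp classical_sets reals.
From mathcomp Require Import topology normedtype ring lra.
Import Order.TTheory GRing.Theory Num.Theory.
Import numFieldNormedType.Exports.
Local Open Scope ring_scope.

(** If every orbit is dense, the orbit of a point x at which a word w is read
    enters the right-neighbourhood of any other point y on which the first
    letters are those of y; reading the letters of x up to that time gives a
    path from w to the word read at y, so every Rauzy graph is connected
    ([dense_orbits_connected]).

    For the converse, suppose that the orbit of x avoids an interval J = [y, y + h[
    and let V be the set of points whose forward orbit enters J.  Every
    semi-open interval is recurrent for a piecewise translation ([recurrence]),
    so V is invariant under T, and it does not contain x.  The point is that the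
    first M + 1 letters of a point decide whether it is in V
    ([invariant_same_word]).  Then so does each edge of the Rauzy graph, which is
    a word of length M + 2: its two ends are both words of V or both words of the
    complement, and the graph connects no word of V to a word outside V
    ([invariant_connected]).

    Suppose that two points with the same M + 1 letters are separated by V.
    Between them lies a boundary point b of V with an interval of V on one side
    ([boundary_between]).  As long as the orbit of b avoids the discontinuities,
    its points are boundary points of V with an interval of V of the same length
    on the same side ([flank_image], [boundary_image]): an interval of V next to a
    boundary point is too far from the discontinuities interior to V for one of
    them to cut it, once it is short.  Infinitely many such points would be
    uniformly separated in [0, 1[, which is impossible, so the orbit of b meets a
    discontinuity ([boundary_hits]).  The inverse of T is again an interval
    exchange, so the backward orbit of b meets a discontinuity of the inverse as
    well.  The two together form a primitive connection through b
    ([boundary_connection]), hence the forward orbit of b meets a discontinuity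
    within M steps.  But b lies inside an interval on which the first M + 1
    letters are constant, where this does not happen ([cylinder_interior]). *)

(** * Two finiteness principles *)

Lemma min_radius (R : realType) (P : R -> R -> Prop) (D : seq R) :
    (forall d e e', P d e -> 0 < e' <= e -> P d e') ->
    (forall d, d \in D -> exists2 e, 0 < e & P d e) ->
  exists2 e, 0 < e & forall d, d \in D -> P d e.
Proof.
move=> Pdown; elim: D => [|d D IH] ex_e; first by exists 1.
have [e e_gt0 Pe] : exists2 e, 0 < e & forall d', d' \in D -> P d' e.
  by apply: IH => d' d'D; apply: ex_e; rewrite inE d'D orbT.
have [e' e'_gt0 Pe'] := ex_e d (mem_head _ _).
have m_gt0 : 0 < Num.min e e' by rewrite lt_min e_gt0.
exists (Num.min e e') => // d'; rewrite inE => /predU1P[->|d'D].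
  by apply: Pdown Pe' _; rewrite m_gt0 ge_min lexx orbT.
by apply: Pdown (Pe _ d'D) _; rewrite m_gt0 ge_min lexx.
Qed.

(** Rounded down in units of [e], the terms take finitely many values, so two of
    them are less than [e] apart. *)
Lemma no_separated_sequence (R : realType) (f : nat -> R) (e : R) :
    0 < e -> (forall n, 0 <= f n < 1) ->
    (forall m n, (m < n)%N -> e <= `|f m - f n|) ->
  False.
Proof.
move=> e_gt0 f01 sep.
pose N := Num.truncn (e^-1).
pose g (i : 'I_N.+2) : 'I_N.+1 := inord (Num.truncn (f i / e)).
have [/leq_card|] := EM (injective g).
  by rewrite !card_ord ltnn.
apply=> i j.
wlog ij : i j / (i < j)%N.
  move=> W; have [/W//|/W H gij|/val_inj//] := ltngtP i j.
  by apply/esym/H.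
have bnd (k : nat) : (Num.truncn (f k / e) < N.+1)%N.
  rewrite ltnS; apply: Num.Theory.le_truncn.
  by have /andP[? ?] := f01 k; rewrite ler_pdivrMr // mulVf ?gt_eqF // ltW.
have fe_ge0 (k : nat) : 0 <= f k / e.
  by have /andP[? ?] := f01 k; rewrite divr_ge0 // ltW.
move/(congr1 val); rewrite /g /= !inordK ?bnd // => eq_tr.
have := truncn_itv (fe_ge0 i); rewrite eq_tr -[X in _ < X]natr1 => bi.
have := truncn_itv (fe_ge0 j); rewrite -[X in _ < X]natr1 => bj.
have : `|f i / e - f j / e| < 1 by rewrite ltr_norml; lra.
rewrite -mulrBl normrM [`|e^-1|]gtr0_norm ?invr_gt0 // ltr_pdivrMr // mul1r.
by rewrite ltNge sep.
Qed.

(** * Boundary points with an interval on one side *)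

(** The neighbourhoods of [z], with the radius kept explicit: intervals of a fixed
    length are followed along orbits below. *)
Definition inner {R : realType} (V : R -> Prop) (z : R) : Prop :=
  exists2 e, 0 < e & forall u, `|u - z| < e -> V u.

(** Both sides are treated together, because the same side of a point is followed
    along its whole orbit. *)
Definition flank {R : realType} (V : R -> Prop) (right : bool) (e z : R) : Prop :=
  forall t, 0 < t < e -> V (if right then z + t else z - t).

Lemma flank_inner (R : realType) (V : R -> Prop) c e z t :
  flank V c e z -> 0 < t < e -> inner V (if c then z + t else z - t).
Proof.
move=> fl tP; have m_gt0 : 0 < Num.min t (e - t) by rewrite lt_min; lra.
exists (Num.min t (e - t)) => // u; rewrite lt_min !ltr_norml.
case: c fl => fl uP.
  have -> : u = z + (u - z) by ring.
  by apply: fl; lra.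
have -> : u = z - (z - u) by ring.
by apply: fl; lra.
Qed.

(** * Piecewise translations of the unit interval *)

(** The hypotheses below are shared by an interval exchange and its inverse;
    [D] is the set of points where [T] may jump, and [T] is continuous on the
    right at these points. *)
Section PiecewiseTranslation.

Variables (R : realType) (T : R -> R) (D : seq R).
Hypothesis T01 : forall x, 0 <= x < 1 -> 0 <= T x < 1.
Hypothesis Ttr : forall x y, 0 <= x -> x <= y -> y < 1 ->
  (forall d, d \in D -> ~~ (x < d <= y)) -> T y = T x + (y - x).

Lemma iter_unit n x : 0 <= x < 1 -> 0 <= iter n T x < 1.
Proof. by move=> x01; elim: n => //= n /T01. Qed.

Hypothesis aper : forall x n, 0 <= x < 1 -> (0 < n)%N -> iter n T x <> x.

Lemma orbit_inj z m n : 0 <= z < 1 -> (m < n)%N -> iter m T z <> iter n T z.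
Proof.
move=> z01 mn; rewrite -(subnK (ltnW mn)) iterD => /esym.
by apply: aper; [exact: iter_unit | rewrite subn_gt0].
Qed.

Section Recurrence.

Hypothesis Tinj :
  forall x y, 0 <= x < 1 -> 0 <= y < 1 -> T x = T y -> x = y.

Lemma iter_inj n x y : 0 <= x < 1 -> 0 <= y < 1 ->
  iter n T x = iter n T y -> x = y.
Proof.
move=> x01 y01; elim: n => //= n IH /Tinj eqT.
by apply: IH; apply: eqT; exact: iter_unit.
Qed.

(** Among the orbits that start in ]y, b[ and meet [p], take one that meets [p]
    soonest, and let it start at [y + e].  By injectivity, an orbit that starts
    between [y] and [y + e] and meets [p] has to pass through [y + e] before. *)
Lemma first_hit_radius b p y : 0 <= y -> b <= 1 ->
  exists2 e, 0 < e & forall n t, 0 < t < e -> y + t < b ->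
    iter n T (y + t) = p ->
    exists2 k, (0 < k <= n)%N & y < iter k T (y + t) < b.
Proof.
move=> y_ge0 b_le1.
pose hits n := `[< exists2 t, 0 < t < b - y & iter n T (y + t) = p >].
have [ex_hit|no_hit] := EM (exists n, hits n); last first.
  exists 1 => // n t t01 ytb eq_p; case: no_hit; exists n; apply/asboolP.
  by exists t => //; lra.
case: (ex_minnP ex_hit) => m /asboolP[t0 t0P eq_p] m_min.
exists t0 => [|n t tP ytb eq_pn]; first by lra.
have mn : (m <= n)%N by apply: m_min; apply/asboolP; exists t => //; lra.
have yt01 : 0 <= y + t < 1 by lra.
have yt001 : 0 <= y + t0 < 1 by lra.
have back : iter (n - m) T (y + t) = y + t0.
  apply: (@iter_inj m) => //; first exact: iter_unit.
  by rewrite -iterD subnKC // eq_pn.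
exists (n - m)%N; last by rewrite back; lra.
rewrite leq_subr andbT lt0n; apply/eqP => nm0.
by move: back; rewrite nm0 /= => ?; lra.
Qed.

(** If [y] does not return to [a, b[, then a short interval K to the right of [y]
    does not return either, and all its iterates are translates: [first_hit_radius]
    says that K would have returned before an iterate of it is cut by a
    discontinuity or by the left end [a].  By injectivity the iterates of K are
    disjoint, which leaves no room for them in [0, 1[. *)
Lemma recurrence a b y : 0 <= a -> b <= 1 -> a <= y < b ->
  exists2 n, (0 < n)%N & a <= iter n T y < b.
Proof.
move=> a_ge0 b_le1 ayb; apply: contrapT => noret.
have y_ge0 : 0 <= y by lra.
pose P p e := forall n t, 0 < t < e -> y + t < b -> iter n T (y + t) = p ->
  exists2 k, (0 < k <= n)%N & y < iter k T (y + t) < b.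
have [e e_gt0 eP] : exists2 e, 0 < e & forall p, p \in a :: D -> P p e.
  apply: min_radius => [p e e' Pe e'P n t tP|p _].
    by apply: Pe; lra.
  exact: first_hit_radius.
pose f := Num.min e (b - y).
have f_gt0 : 0 < f by rewrite lt_min e_gt0 subr_gt0; case/andP: ayb.
have fe : f <= e by rewrite ge_min lexx.
have fb : f <= b - y by rewrite ge_min lexx orbT.
have transl n : (forall t, 0 <= t < f -> iter n T (y + t) = iter n T y + t) /\
    (forall k t, (0 < k <= n)%N -> 0 <= t < f -> ~ a <= iter k T (y + t) < b).
  elim: n => [|n [IHt IHr]]; first by split=> [//|[|k]].
  (* A discontinuity inside the n-th iterate of K would force an earlier return. *)
  have tr t : 0 <= t < f -> iter n.+1 T (y + t) = iter n.+1 T y + t.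
    move=> tP; rewrite !iterS IHt //.
    have y01 : 0 <= iter n T y < 1 by apply: iter_unit; lra.
    have yt01 : 0 <= iter n T y + t < 1.
      by rewrite -IHt //; apply: iter_unit; lra.
    rewrite (Ttr (iter n T y) (iter n T y + t)) => [|||//|d dD]; try lra.
    apply/negP => dP; pose t' := d - iter n T y.
    have t'P : 0 < t' < f by rewrite /t'; lra.
    have [k kn kP] : exists2 k, (0 < k <= n)%N & y < iter k T (y + t') < b.
      apply: (eP d) => //; first by rewrite inE dD orbT.
      - lra.
      - lra.
      - by rewrite IHt /t'; lra.
    by apply: (IHr k t') => //; lra.
  split=> [//|k t]; rewrite [(k <= _)%N]leq_eqVlt ltnS.
  case: eqVneq => [-> _ tP|_ /= kn tP]; last exact: IHr.
  rewrite tr // => tJ.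
  have yJ : ~ a <= iter n.+1 T y < b by move=> yJ; apply: noret; exists n.+1.
  (* An iterate of K that meets J, but not at its left end, contains [a]; the
     point [a] being outside ]y, b[, the return came at an earlier time. *)
  pose t' := a - iter n.+1 T y.
  have t'P : 0 < t' <= t.
    by case: (lerP a (iter n.+1 T y)) => ?; [case: yJ|rewrite /t']; lra.
  have eq_a : iter n.+1 T (y + t') = a by rewrite tr /t'; lra.
  have [k' k'n k'P] : exists2 k, (0 < k <= n.+1)%N & y < iter k T (y + t') < b.
    by apply: (eP a) => //; [rewrite inE eqxx | lra | lra].
  move: k'n; rewrite [(k' <= _)%N]leq_eqVlt ltnS.
  case: eqVneq => [k'E _|_ /= k'n]; first by rewrite k'E eq_a in k'P; lra.
  by apply: (IHr k' t') => //; lra.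
apply: (@no_separated_sequence R (fun n => iter n T y) f f_gt0) => [n|m n mn].
  by apply: iter_unit; lra.
rewrite leNgt; apply/negP; rewrite ltr_norml => close.
have [trm _] := transl m; have [trn ret] := transl n.
(* If two iterates of K meet, cancelling the smaller number of steps gives a point
   of K that returns. *)
have stay t t' : 0 <= t < f -> 0 <= t' < f ->
    iter n T (y + t) = iter m T (y + t') -> False.
  move=> tP t'P eq_mn; apply: (ret (n - m)%N t) => //.
    by rewrite leq_subr andbT subn_gt0.
  suff -> : iter (n - m) T (y + t) = y + t' by lra.
  apply: (@iter_inj m); [by apply: iter_unit; lra | lra |].
  by rewrite -iterD subnKC // ltnW.
have [le_mn|lt_nm] := lerP (iter m T y) (iter n T y).
  by apply: (stay 0 (iter n T y - iter m T y)); rewrite ?trm ?trn; lra.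
by apply: (stay (iter m T y - iter n T y) 0); rewrite ?trm ?trn; lra.
Qed.

End Recurrence.
(** * Boundary of an invariant set of a piecewise translation *)

Section InvariantSet.

Variable V : R -> Prop.
Hypothesis V01 : forall x, V x -> 0 <= x < 1.
Hypothesis VT : forall x, 0 <= x < 1 -> V (T x) <-> V x.

(** A discontinuity in the open interval of [V] next to [z] is interior to [V].
    Finitely many discontinuities are interior to [V], and they have a common
    radius; as [z] is not interior to [V], it is at least this far from them. *)
Lemma flank_free : exists2 e, 0 < e & forall c f z t,
  f <= e -> ~ inner V z -> flank V c f z -> 0 < t < f ->
  (if c then z + t else z - t) \notin D.
Proof.
have [e e_gt0 eP] : exists2 e, 0 < e & forall d, d \in D ->
    inner V d -> forall u, `|u - d| < e -> V u.
  apply: min_radius => [d e e' de e'P /de dV u uP|d _]; first by apply: dV; lra.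
  have [[e e_gt0 eV]|nin] := EM (inner V d); last by exists 1.
  by exists e.
exists e => // c f z t fe nin fl tP; apply/negP => dD; apply: nin.
have {}eP := eP _ dD (flank_inner _ _ _ _ _ _ fl tP).
exists (e - t) => [|u]; first by lra.
by rewrite ltr_norml => uP; apply: eP; rewrite ltr_norml; case: (c); lra.
Qed.

(** On the left side the interval is closed at [z], so [z] itself must not be a
    discontinuity; on the right side [T] is a translation from [z] on. *)
Lemma flank_image : exists2 e, 0 < e & forall c f z,
  0 < f <= e -> 0 <= z < 1 -> ~ inner V z -> flank V c f z ->
  c \/ z \notin D -> flank V c f (T z).
Proof.
have [e e_gt0 eP] := flank_free; exists e => // c f z fP z01 nin fl cz t tP.
have {}eP t' : 0 < t' < f -> _ := eP c f z t' (proj2 (andP fP)) nin fl.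
have Vt := fl t tP; have t01 := V01 _ Vt.
suff <- : T (if c then z + t else z - t) = if c then T z + t else T z - t.
  by apply/VT.
case: c {fl Vt} t01 eP cz => t01 eP cz.
  rewrite (Ttr z (z + t)) => [|||//|d dD]; try lra.
  apply/negP => dP; have /negP[] : z + (d - z) \notin D by apply: eP; lra.
  by rewrite addrC subrK.
rewrite (Ttr (z - t) z) => [|||//|d dD]; try lra.
apply/negP => dP; have [dz|dz] := eqVneq d z.
  by case: cz => // /negP[]; rewrite -dz.
have /negP[] : z - (z - d) \notin D.
  by apply: eP; move: dz; rewrite neq_lt => /orP[]; lra.
by rewrite opprB addrC subrK.
Qed.

(** Two points of the orbit less than [f] apart would put one of them into the
    open interval of [V] next to the other, hence in the interior of [V]. *)
Lemma flank_not_invariant c f z : 0 < f -> 0 <= z < 1 ->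
    (forall n, ~ inner V (iter n T z)) ->
    (forall n, flank V c f (iter n T z)) ->
  False.
Proof.
move=> f_gt0 z01 nin fl.
apply: (@no_separated_sequence R (fun n => iter n T z) f f_gt0) => [n|m n mn].
  exact: iter_unit.
rewrite leNgt; apply/negP; rewrite ltr_norml => close.
have : iter m T z != iter n T z by apply/eqP; apply: orbit_inj.
have apart k l : 0 < iter k T z - iter l T z < f -> False.
  move=> klP; case: c fl => fl.
    apply: (nin k); have := flank_inner _ _ _ _ _ _ (fl l) klP.
    by rewrite addrC subrK.
  apply: (nin l); have := flank_inner _ _ _ _ _ _ (fl k) klP.
  by rewrite opprB addrC subrK.
rewrite neq_lt => /orP[lt_mn|lt_nm]; first by apply: (apart n m); lra.
by apply: (apart m n); lra.
Qed.

Lemma flankW c f f' z : f' <= f -> flank V c f z -> flank V c f' z.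
Proof. by move=> f'f fl t tP; apply: fl; lra. Qed.

Lemma notin_not_inner z : ~ V z -> ~ inner V z.
Proof. by move=> nV [e e0 eV]; apply: nV; apply: eV; rewrite subrr normr0. Qed.

(** The orbit stays outside [V], hence on its boundary, and right-hand intervals
    are never cut off at their left end: no discontinuity can stop them. *)
Lemma outside_no_right_flank f z :
  0 < f -> 0 <= z < 1 -> ~ V z -> ~ flank V true f z.
Proof.
move=> f_gt0 z01 nV fl; have [e e_gt0 eP] := flank_image.
have m_gt0 : 0 < Num.min f e by rewrite lt_min f_gt0.
have nVn n : ~ V (iter n T z).
  elim: n => //= n IH VT'; apply: IH; apply/VT => //; exact: iter_unit.
apply: (@flank_not_invariant true (Num.min f e) z) => // n.
  exact: notin_not_inner.
elim: n => [|n IH] /=; first by apply: flankW fl; rewrite ge_min lexx.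
apply: eP => //; [|exact: iter_unit|exact: notin_not_inner|by left].
by rewrite m_gt0 ge_min lexx orbT.
Qed.

Lemma translation_near z : 0 < z < 1 -> z \notin D ->
  exists2 e, 0 < e & forall u, `|u - z| < e -> 0 <= u < 1 /\ T u = T z + (u - z).
Proof.
move=> z01 zD.
have [e e_gt0 eP] : exists2 e, 0 < e & forall d, d \in D -> e <= `|d - z|.
  apply: min_radius => [d e e'|d dD]; first by lra.
  exists `|d - z| => //; rewrite normr_gt0 subr_eq0.
  by apply: contraNneq zD => <-.
have m_gt0 : 0 < Num.min e (Num.min z (1 - z)) by rewrite !lt_min; lra.
exists (Num.min e (Num.min z (1 - z))) => // u; rewrite !lt_min !ltr_norml => uP.
have u01 : 0 <= u < 1 by lra.
split=> //.
have noD d : d \in D -> d - z < e -> - e < d - z -> False.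
  by move=> /eP /[swap] ? /[swap] ?; rewrite leNgt ltr_norml => /negP[]; lra.
have [zu|uz] := lerP z u.
  apply: Ttr => [|||d dD]; try lra.
  by apply/negP => dP; apply: (noD d dD); lra.
suff -> : T z = T u + (z - u) by ring.
apply: Ttr => [|||d dD]; try lra.
by apply/negP => dP; apply: (noD d dD); lra.
Qed.

Lemma boundary_image z : 0 < z < 1 -> z \notin D -> ~ inner V z ->
  0 < T z < 1 /\ ~ inner V (T z).
Proof.
move=> z01 zD nin; have [e e_gt0 eP] := translation_near _ z01 zD.
have z01' : 0 <= z < 1 by lra.
have Tz01 := T01 _ z01'; split.
  have near : `|z - e / 2 - z| < e by rewrite ltr_norml; lra.
  have [/T01 + E] := eP _ near; rewrite E; lra.
move=> [f f_gt0 fV]; apply: nin; exists (Num.min e f) => [|u].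
  by rewrite lt_min e_gt0.
rewrite lt_min => /andP[/eP[u01 E] uf]; apply/VT => //.
by apply: fV; rewrite E addrC addKr.
Qed.

(** The positivity of the points on the way is needed because 0 may be the image
    of a discontinuity without being a discontinuity of the inverse. *)
Lemma boundary_hits c f b : 0 < f -> 0 < b < 1 -> ~ inner V b ->
    flank V c f b ->
  exists n, [/\ iter n T b \in D, forall k, (k < n)%N -> iter k T b \notin D
    & forall k, (k <= n)%N -> 0 < iter k T b].
Proof.
move=> f_gt0 b01 nin fl.
have bd n : (forall k, (k < n)%N -> iter k T b \notin D) ->
    0 < iter n T b < 1 /\ ~ inner V (iter n T b).
  elim: n => [//|n IH] noD; have [k kn|n01 nn] := IH.
    by apply: noD; rewrite ltnS ltnW.
  by apply: boundary_image => //; apply: noD.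
have [hit|nohit] := EM (exists n, iter n T b \in D).
  case: (ex_minnP hit) => n nD n_min.
  have noD k : (k < n)%N -> iter k T b \notin D.
    by apply: contraTN => /n_min; rewrite -leqNgt.
  exists n; split=> // k kn; have [|/andP[]//] := bd k.
  by move=> l lk; apply: noD; apply: leq_trans kn.
have {}nohit n : iter n T b \notin D by apply/negP => ?; apply: nohit; exists n.
have [e e_gt0 eP] := flank_image.
have m_gt0 : 0 < Num.min f e by rewrite lt_min f_gt0.
have b01' : 0 <= b < 1 by lra.
case: (@flank_not_invariant c (Num.min f e) b) => // n.
  by have [] := bd n (fun k _ => nohit k).
elim: n => [|n IH] /=; first by apply: flankW fl; rewrite ge_min lexx.
apply: eP => //; [|exact: iter_unit| |by right].
  by rewrite m_gt0 ge_min lexx orbT.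
by have [] := bd n (fun k _ => nohit k).
Qed.

End InvariantSet.

End PiecewiseTranslation.

(** The boundary point is the infimum of the points after [z], or the supremum of
    the points before [z], that are outside [V].  The supremum can be the end
    [z1] itself; then [z1] is outside [V] with an interval of [V] on its right,
    the situation that [outside_no_right_flank] excludes. *)
Lemma boundary_between (R : realType) (V : R -> Prop) (z z1 : R) :
    (forall x, V x -> 0 <= x < 1) ->
    (forall x, V x -> exists2 e : R, 0 < e & forall t, 0 <= t < e -> V (x + t)) ->
    V z -> ~ V z1 ->
  exists b c f, [/\ 0 < f, ~ inner V b, flank V c f b &
    (b = z1 /\ c) \/ Num.min z z1 < b <= Num.max z z1].
Proof.
move=> V01 Vright Vz nVz1; have [e e_gt0 eV] := Vright z Vz.
have zz1 : z != z1 by apply/eqP => zz1; rewrite -zz1 in nVz1.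
have [lt_zz1|le_z1z] := ltP z z1.
  pose E := [set t | z <= t /\ ~ V t]%classic.
  have Ez1 : E z1 by split=> //; exact: ltW.
  have lbE : has_lbound E by exists z => t [].
  have infE : has_inf E by split=> //; exists z1.
  pose b := inf E.
  have bz1 : b <= z1 by exact: ge_inf.
  have below t : z <= t < b -> V t.
    move=> /andP[zt]; apply: contraPP => nVt; apply/negP; rewrite -leNgt.
    by apply: ge_inf.
  have zb : z + e <= b.
    apply: lb_le_inf; first by exists z1.
    move=> t [zt nVt]; rewrite leNgt; apply/negP => lt_t; apply: nVt.
    have -> : t = z + (t - z) by ring.
    by apply: eV; lra.
  have nVb : ~ V b.
    move=> /Vright[f f_gt0 fV].
    have [t [zt nVt] tP] := inf_adherent f_gt0 infE.
    have bt : b <= t by apply: ge_inf.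
    apply: nVt; have -> : t = b + (t - b) by ring.
    by apply: fV; rewrite -/b in tP; lra.
  exists b, false, (b - z); split.
  - by lra.
  - exact: notin_not_inner.
  - by move=> t tP; apply: below; lra.
  - by right; lra.
have lt_z1z : z1 < z by rewrite lt_neqAle eq_sym zz1.
pose E := [set t | t <= z /\ ~ V t]%classic.
have Ez1 : E z1 by split.
have ubE : has_ubound E by exists z => t [].
have supE : has_sup E by split=> //; exists z1.
pose b := sup E.
have z1b : z1 <= b by exact: ub_le_sup.
have bz : b <= z by apply: ge_sup => [|t []//]; exists z1.
have above t : b < t <= z -> V t.
  move=> /andP[+ tz]; apply: contraPP => nVt; apply/negP; rewrite -leNgt.
  by apply: ub_le_sup.
exists b, true, (z + e - b); split.
- by lra.
- move=> [f f_gt0 fV].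
  have [t [tz nVt] tP] := sup_adherent f_gt0 supE.
  have tb : t <= b by apply: ub_le_sup.
  by apply: nVt; apply: fV; rewrite ltr_norml; rewrite -/b in tP; lra.
- move=> t tP; have [btz|ztb] := lerP (b + t) z; first by apply: above; lra.
  have -> : b + t = z + (b + t - z) by ring.
  by apply: eV; lra.
- have [->|bz1] := eqVneq b z1; first by left.
  by right; move: bz1; rewrite neq_lt => /orP[]; lra.
Qed.

Lemma mkseq_cons (A : Type) (f : nat -> A) n :
  mkseq f n.+1 = f 0%N :: mkseq (fun k => f k.+1) n.
Proof. by rewrite /mkseq /= (iotaDl 1 0) -map_comp. Qed.

Definition discs {R : realType} {r : nat} (lam : 'I_r -> R) : seq R :=
  [seq disc lam k | k <- iota 1 r.-1].

(** * Interval exchanges as piecewise translations *)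

Section IntervalExchange.

Variables (R : realType) (r : nat).
Implicit Types (lam : 'I_r -> R) (s : 'S_r).

Lemma discsP lam d :
  reflect (exists2 k, (0 < k < r)%N & d = disc lam k) (d \in discs lam).
Proof.
apply: (iffP mapP) => -[k kP ->]; exists k => //; move: kP;
  rewrite mem_iota; case: (r) => [|n]; rewrite ?add1n //=.
  by case: k.
by case: k.
Qed.

Lemma disc0 lam : disc lam 0 = 0.
Proof. by rewrite /disc big_pred0. Qed.

Lemma discS lam (i : 'I_r) : disc lam i.+1 = disc lam i + lam i.
Proof.
rewrite /disc (bigD1 i) //= addrC; congr (_ + _); apply: eq_bigl => j.
by rewrite ltnS [in RHS]ltn_neqAle andbC.
Qed.

Section Lengths.

Variable lam : 'I_r -> R.
Hypothesis lam_gt0 : forall i, 0 < lam i.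
Hypothesis lam_sum : \sum_(i < r) lam i = 1.

Lemma disc_le k l : (k <= l)%N -> disc lam k <= disc lam l.
Proof.
move=> kl; rewrite /disc [X in _ <= X](bigID (fun j : 'I_r => (j < k)%N)) /=.
rewrite [X in _ <= X + _](eq_bigl (fun j : 'I_r => (j < k)%N)) => [|j].
  by rewrite lerDl sumr_ge0 // => j _; exact: ltW.
by rewrite andbC; case: ltnP => //= jk; rewrite (leq_trans jk kl).
Qed.

Lemma disc_r : disc lam r = 1.
Proof. by rewrite -lam_sum /disc; apply: eq_bigl => j; rewrite ltn_ord. Qed.

Lemma interv_unit i x : interv lam i x -> 0 <= x < 1.
Proof.
rewrite /interv /= => /andP[ix xi]; rewrite -(disc0 lam) -disc_r.
by rewrite (le_trans (disc_le _ _ (leq0n i)) ix) (lt_le_trans xi (disc_le _ _ _)).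
Qed.

Lemma interv_ex x : 0 <= x < 1 -> exists i, interv lam i x.
Proof.
move=> /andP[x0 x1].
have ex_k : exists k, x < disc lam k by exists r; rewrite disc_r.
case: (ex_minnP ex_k) => -[|k] kP kmin.
  by move: kP; rewrite disc0 ltNge x0.
have kr : (k < r)%N by apply: kmin; rewrite disc_r.
exists (Ordinal kr); rewrite /interv /= kP andbT leNgt.
by apply/negP => /kmin; rewrite ltnn.
Qed.

Lemma interv_lt i j x y : interv lam i x -> interv lam j y -> (i < j)%N ->
  x < disc lam i.+1 <= y.
Proof.
rewrite /interv /= => /andP[_ ->] /andP[jy _] /= ij.
exact: le_trans (disc_le _ _ ij) jy.
Qed.

Lemma interv_inj i j x : interv lam i x -> interv lam j x -> i = j.
Proof.
move=> ix jx; apply/val_inj; have [ij|ji|//] := ltngtP i j.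
  by exfalso; have := interv_lt _ _ _ _ ix jx ij; lra.
by exfalso; have := interv_lt _ _ _ _ jx ix ji; lra.
Qed.

Lemma iet_interv s i x : interv lam i x ->
  iet lam s x = x + disc_inv lam s ((s^-1)%g i) - disc lam i.
Proof.
move=> ix; rewrite /iet; case: pickP => [j jx|/(_ i)]; last by rewrite [_ && _]ix.
by rewrite -(interv_inj _ _ _ ix jx).
Qed.

Lemma iet_translation s i x y : interv lam i x -> interv lam i y ->
  iet lam s y = iet lam s x + (y - x).
Proof. by move=> /(iet_interv s) -> /(iet_interv s) ->; ring. Qed.

Lemma iet_piecewise s x y : 0 <= x -> x <= y -> y < 1 ->
  (forall d, d \in discs lam -> ~~ (x < d <= y)) ->
  iet lam s y = iet lam s x + (y - x).
Proof.
move=> x0 xy y1 noD.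
have [i ix] : exists i, interv lam i x by apply: interv_ex; lra.
have [j jy] : exists j, interv lam j y by apply: interv_ex; lra.
suff ij : i = j by apply: iet_translation ix _; rewrite ij.
apply/val_inj; have [ij|ji|//] := ltngtP i j.
  have dD : disc lam i.+1 \in discs lam.
    by apply/discsP; exists i.+1 => //=; rewrite (leq_ltn_trans ij).
  by have := noD _ dD; rewrite (interv_lt _ _ _ _ ix jy ij).
by exfalso; have := interv_lt _ _ _ _ jy ix ji; lra.
Qed.

Lemma interior_notin_discs i x :
  disc lam i < x < disc lam i.+1 -> x \notin discs lam.
Proof.
move=> ix; apply/discsP => -[k _ xk]; have [ki|ik] := leqP k i.
  by have := disc_le _ _ ki; lra.
by have := disc_le _ _ ik; lra.
Qed.

Lemma trajectory_ex s x : (forall n, 0 <= iter n (iet lam s) x < 1) ->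
  exists u, trajectory lam s x u.
Proof.
move=> x01.
have [u uP] := choice (fun n => interv_ex _ (x01 n)).
by exists u.
Qed.

(** [T] is continuous on the right, so the points just to the right of [x] share
    its first [n] letters and move along with it. *)
Lemma cylinder_right s x u n : trajectory lam s x u ->
  exists2 e, 0 < e & forall t, 0 <= t < e ->
    (forall k, (k < n)%N -> interv lam (u k) (iter k (iet lam s) (x + t))) /\
    iter n (iet lam s) (x + t) = iter n (iet lam s) x + t.
Proof.
move=> xu; elim: n => [|n [e e_gt0 IH]]; first by exists 1.
have un := xu n; have := un; rewrite {1}/interv /= => un'.
pose f := Num.min e (disc lam (u n).+1 - iter n (iet lam s) x).
have f_gt0 : 0 < f by rewrite lt_min e_gt0; lra.
exists f => // t; rewrite lt_min => tP.
have [|tk tn] := IH t; first by lra.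
have utn : interv lam (u n) (iter n (iet lam s) (x + t)).
  by rewrite tn /interv /=; lra.
split=> [k|]; last by rewrite /= (iet_translation _ _ _ _ un utn) tn; ring.
by rewrite ltnS leq_eqVlt => /predU1P[->//|/tk].
Qed.

(** The iterates of [b] stay strictly to the right of those of [x] and inside the
    same intervals, so they avoid the left ends of these intervals. *)
Lemma cylinder_interior s (w : nat -> 'I_r) n x y b :
    (forall k, (k < n)%N -> interv lam (w k) (iter k (iet lam s) x)) ->
    (forall k, (k < n)%N -> interv lam (w k) (iter k (iet lam s) y)) ->
    x < b <= y ->
  forall k, (k < n)%N -> iter k (iet lam s) b \notin discs lam.
Proof.
move=> xw yw xby k kn.
have [bk yk] : iter k (iet lam s) b = iter k (iet lam s) x + (b - x) /\
    iter k (iet lam s) y = iter k (iet lam s) x + (y - x).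
  elim: k kn => [|k IH] kn; first by split=> /=; ring.
  have [bk yk] := IH (ltnW kn); have xk := xw _ (ltnW kn); have ykw := yw _ (ltnW kn).
  have bkw : interv lam (w k) (iter k (iet lam s) b).
    by move: xk ykw; rewrite bk yk /interv /=; lra.
  rewrite !iterS (iet_translation _ _ _ _ xk bkw) (iet_translation _ _ _ _ xk ykw).
  by rewrite bk yk; split; ring.
apply: (interior_notin_discs (w k)); move: (xw k kn) (yw k kn).
by rewrite bk yk /interv /=; lra.
Qed.

End Lengths.

(** * The inverse of an interval exchange *)

(** The inverse exchanges the intervals [T I_(s 0)], ..., [T I_(s (r - 1))], whose
    lengths are [lam \o s], by the inverse permutation. *)
Section Inverse.

Variables (lam : 'I_r -> R) (s : 'S_r).
Hypothesis lam_gt0 : forall i, 0 < lam i.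
Hypothesis lam_sum : \sum_(i < r) lam i = 1.

Let lam' : 'I_r -> R := lam \o s.

Lemma disc_comp k : disc lam' k = disc_inv lam s k.
Proof.
rewrite /disc /disc_inv [RHS](reindex_inj (@perm_inj _ s)) /=.
by apply: eq_bigl => i; rewrite permK.
Qed.

Lemma disc_inv_comp k : disc_inv lam' (s^-1)%g k = disc lam k.
Proof.
rewrite /disc /disc_inv [RHS](reindex_inj (@perm_inj _ s)) /=.
by apply: eq_bigl => i; rewrite invgK.
Qed.

Lemma lam_comp_gt0 i : 0 < lam' i. Proof. exact: lam_gt0. Qed.

Lemma lam_comp_sum : \sum_(i < r) lam' i = 1.
Proof. by rewrite -lam_sum [RHS](reindex_inj (@perm_inj _ s)). Qed.

Lemma interv_image i x :
  interv lam i x -> interv lam' ((s^-1)%g i) (iet lam s x).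
Proof.
move=> ix; rewrite (iet_interv _ lam_gt0 _ _ _ ix); move: ix.
rewrite /interv /= discS discS !disc_comp /lam' /= permKV; lra.
Qed.

Lemma iet_unit x : 0 <= x < 1 -> 0 <= iet lam s x < 1.
Proof.
move=> /(interv_ex _ lam_sum)[i /interv_image].
exact: interv_unit lam_comp_gt0 lam_comp_sum _ _.
Qed.

Lemma ietK x : 0 <= x < 1 -> iet lam' (s^-1)%g (iet lam s x) = x.
Proof.
move=> /(interv_ex _ lam_sum)[i ix].
rewrite (iet_interv _ lam_comp_gt0 _ _ _ (interv_image _ _ ix)) invgK permKV.
by rewrite disc_inv_comp disc_comp (iet_interv _ lam_gt0 _ _ _ ix); ring.
Qed.

Lemma iet_inj x y : 0 <= x < 1 -> 0 <= y < 1 -> iet lam s x = iet lam s y -> x = y.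
Proof. by move=> /ietK {2}<- /ietK {2}<- ->. Qed.

Lemma iet_disc k : (0 < k < r)%N ->
  iet lam s (disc lam k) = 0 \/ iet lam s (disc lam k) \in discs lam'.
Proof.
move=> /andP[k0 kr]; pose i := Ordinal kr.
have ik : interv lam i (disc lam k).
  by rewrite /interv /= lexx (discS lam i) ltrDl; exact: lam_gt0.
rewrite (iet_interv _ lam_gt0 _ _ _ ik) [disc lam k + _]addrC addrK -disc_comp.
have [->|i0] := posnP ((s^-1)%g i); first by left; rewrite disc0.
by right; apply/discsP; exists ((s^-1)%g i) => //; rewrite i0 ltn_ord.
Qed.

End Inverse.

(** * Lengths of primitive connections *)

(** A primitive connection stops at the first discontinuity that it meets, so its
    starting index determines its length and there is a largest length. *)
Lemma connection_le_max lam s n i j :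
  primitive_connection lam s n i j -> (n <= max_connection lam s)%N.
Proof.
move=> nij.
have bound i' : exists B, forall m j', primitive_connection lam s m i' j' ->
    (m <= B)%N.
  have [[m [l ml]]|none] := EM (exists m l, primitive_connection lam s m i' l).
    exists m => m' l' [_ _ _ prim]; have [_ lP Tl _] := ml.
    by rewrite leqNgt; apply/negP => mm'; exact: (prim l m lP mm' Tl).
  by exists 0%N => m l ml; case: none; exists m, l.
have [B BP] := choice bound.
have CB m : `[< connection_length lam s m >] -> (m <= \max_(k < r) B k)%N.
  move=> /asboolP[k [l mkl]]; have [/andP[_ kr] _ _ _] := mkl.
  exact: leq_trans (BP _ _ _ mkl) (leq_bigmax (Ordinal kr)).
have exC : exists m, `[< connection_length lam s m >].
  by exists n; apply/asboolP; exists i, j.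
case: (ex_maxnP exC CB) => m mC m_max.
have [|_ maxP] := xgetPex 0%N (P := [set n | connection_length lam s n /\
    forall m, connection_length lam s m -> (m <= n)%N]%classic).
  by exists m; split=> [|k kC]; [exact/asboolP | exact/m_max/asboolP].
by apply: maxP; exists i, j.
Qed.

(** * Dense orbits and connected Rauzy graphs *)

Section Exchange.

Variables (lam : 'I_r -> R) (s : 'S_r).
Hypothesis lam_gt0 : forall i, 0 < lam i.
Hypothesis lam_sum : \sum_(i < r) lam i = 1.

Local Notation T := (iet lam s).
Local Notation S := (iet (lam \o s) (s^-1)%g).

Let T01 := @iet_unit lam s lam_gt0 lam_sum.
Let lam'_gt0 := @lam_comp_gt0 lam s lam_gt0.
Let lam'_sum := @lam_comp_sum lam s lam_sum.
Let S01 := @iet_unit (lam \o s) (s^-1)%g lam'_gt0 lam'_sum.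

Lemma ietVK x : 0 <= x < 1 -> T (S x) = x.
Proof.
move=> x01; have := @ietK (lam \o s) (s^-1)%g lam'_gt0 lam'_sum x x01.
have -> : (lam \o s) \o (s^-1)%g = lam by apply/funext => i /=; rewrite permKV.
by rewrite invgK.
Qed.

Lemma iter_ietVK k q x : 0 <= x < 1 -> (k <= q)%N ->
  iter k T (iter q S x) = iter (q - k) S x.
Proof.
move=> x01; elim: k q => [|k IH] [|q] //= kq.
by rewrite -iterS iterSr ietVK ?IH ?iter_unit.
Qed.

Definition word (f : nat -> 'I_r) (n : nat) : n.-tuple 'I_r :=
  Tuple (introT eqP (size_mkseq f n)).

Lemma trajectory_shift x u m : trajectory lam s x u ->
  trajectory lam s (iter m T x) (fun k => u (m + k)%N).
Proof. by move=> xu k; rewrite -iterD addnC. Qed.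

Lemma word_language x u n :
  0 <= x < 1 -> trajectory lam s x u -> language lam s (word u n).
Proof.
move=> x01 xu; exists x, u; split=> //.
by exists 0%N; rewrite size_tuple.
Qed.

Lemma language_word w : language lam s w ->
  exists x u, [/\ 0 <= x < 1, trajectory lam s x u & w = mkseq u (size w)].
Proof.
move=> [x [u [x01 xu [m wE]]]].
exists (iter m T x), (fun k => u (m + k)%N); split=> //.
  exact: iter_unit.
exact: trajectory_shift.
Qed.

Lemma closure_orbit x (y : R) : closure (orbit_of T x) y <->
  forall e, 0 < e -> exists n, `|y - iter n T x| < e.
Proof.
split=> [cl e e_gt0|cl B /nbhs_ballP[e /= e_gt0 eB]].
  have [_ [[n _ <-] yn]] := cl _ (nbhsx_ballx y e e_gt0).
  by exists n.
have [n yn] := cl e e_gt0.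
by exists (iter n T x); split; [exists n | exact: eB].
Qed.

(** The path follows the letters read along the orbit of [x] until it enters the
    right-neighbourhood of [y] on which the first letters are those of [y]. *)
Lemma dense_orbits_connected n :
  (forall x y e, 0 <= x < 1 -> 0 <= y < 1 -> 0 < e ->
    exists n, `|y - iter n T x| < e) ->
  rauzy_connected (language lam s) n.+1.
Proof.
move=> dense w w' /language_word[x [f [x01 xf wE]]].
move=> /language_word[y [g [y01 yg w'E]]]; rewrite !size_tuple in wE w'E.
have [e e_gt0 eP] := cylinder_right _ lam_gt0 s y g n.+1 yg.
pose h := Num.min e (1 - y).
have h_gt0 : 0 < h by rewrite lt_min e_gt0; lra.
have [he h1] : h <= e /\ h <= 1 - y by rewrite !ge_min !lexx orbT.
(* The ball around the middle of [y, y + h[ lies to the right of [y]. *)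
have [||m] := dense x (y + h / 2) (h / 2) x01; [lra|lra|].
rewrite ltr_norml => mP.
have [|mg _] := eP (iter m T x - y); first by lra.
rewrite addrC subrK in mg.
have fg k : (k < n.+1)%N -> g k = f (m + k)%N.
  move=> kn; apply: (interv_inj _ lam_gt0 _ _ _ (mg k kn)).
  exact: (trajectory_shift x f m xf k).
have -> : w = word f n.+1 by apply/val_inj.
have -> : w' = word (fun k => f (m + k)%N) n.+1.
  apply/val_inj; rewrite /= w'E; apply/eq_in_map => k.
  by rewrite mem_iota => /fg.
elim: m {mP mg fg} => [|m IH].
  by rewrite (_ : word _ _ = word f n.+1) //; apply: val_inj; apply: eq_map.
apply: connect_trans IH _; apply: connect1; apply/orP; left; apply/asboolP.
pose u k := f (m + k)%N.
exists (u 0%N), (u n.+1), (mkseq (fun k => u k.+1) n); split.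
- by rewrite -(mkseq_cons _ u) /= /u; apply: eq_map.
- rewrite /= -mkseqS; apply: eq_map => k; by rewrite /u addSnnS.
rewrite -[rcons _ _]mkseqS.
have -> : u 0%N :: mkseq (fun k => u k.+1) n.+1 = word u n.+2.
  by rewrite -(mkseq_cons _ u).
apply: (word_language (iter m T x)); [exact: iter_unit|exact: trajectory_shift].
Qed.

Hypothesis aper : forall x n, 0 <= x < 1 -> (0 < n)%N -> iter n T x <> x.

Lemma iet_inverse_aperiodic x n : 0 <= x < 1 -> (0 < n)%N -> iter n S x <> x.
Proof.
move=> x01 n0 Sx; apply: (aper x n x01 n0).
by rewrite -[in LHS]Sx iter_ietVK // subnn.
Qed.

Section InvariantSet.

Variable V : R -> Prop.
Hypothesis V01 : forall x, V x -> 0 <= x < 1.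
Hypothesis VT : forall x, 0 <= x < 1 -> V (T x) <-> V x.
Hypothesis Vright :
  forall x, V x -> exists2 e : R, 0 < e & forall t, 0 <= t < e -> V (x + t).

Lemma invariant_inverse x : 0 <= x < 1 -> V (S x) <-> V x.
Proof. by move=> x01; rewrite -(VT (S x)) ?ietVK //; exact: S01. Qed.

(** The connection starts at the first backward iterate of [b] that is a
    discontinuity of the inverse and ends at its first forward iterate that is a
    discontinuity.  It is primitive: [T] sends a discontinuity to 0 or to a
    discontinuity of the inverse, so one met before [b] would give 0 or an earlier
    discontinuity of the inverse in the backward orbit of [b]. *)
Lemma boundary_connection c f b : 0 < f -> 0 < b < 1 -> ~ inner V b ->
    flank V c f b ->
  exists n, [/\ (n <= max_connection lam s)%N & iter n T b \in discs lam].
Proof.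
move=> f0 b01 nin fl; have b01' : 0 <= b < 1 by lra.
have [n [nD noD _]] := @boundary_hits R T (discs lam) T01
  (iet_piecewise _ lam_gt0 lam_sum s) aper V V01 VT c f b f0 b01 nin fl.
have [q [qD noDS q_gt0]] := @boundary_hits R S (discs (lam \o s)) S01
  (iet_piecewise _ lam'_gt0 lam'_sum _) iet_inverse_aperiodic V V01
  invariant_inverse c f b f0 b01 nin fl.
exists n; split=> //.
have [i iP qi] := discsP _ _ qD; have [j jP nj] := discsP _ _ nD.
have Tq : iter q T (disc_inv lam s i) = b.
  by rewrite -disc_comp -qi iter_ietVK // subnn.
apply: (@leq_trans (n + q)); first exact: leq_addr.
apply: (@connection_le_max lam s _ i j); split=> //.
  by rewrite iterD Tq.
move=> k p kP pnq Tp; have [qp|pq] := leqP q p.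
  have lt_pqn : (p - q < n)%N by rewrite ltn_subLR // addnC.
  have /discsP[] := noD _ lt_pqn.
  by exists k => //; rewrite -Tq -iterD subnK.
have SqpE : iter p.+1 T (disc_inv lam s i) = iter (q - p.+1) S b.
  by rewrite -disc_comp -qi iter_ietVK.
have qp : (q - p.+1 < q)%N by rewrite ltn_subrL (leq_ltn_trans _ pq).
move: SqpE; rewrite iterS Tp => SqpE.
have [T0|TD] := iet_disc lam s lam_gt0 k kP.
  by have := q_gt0 _ (ltnW qp); rewrite -SqpE T0 ltxx.
by have := noDS _ qp; rewrite -SqpE TD.
Qed.

Lemma invariant_same_word x y u v :
    trajectory lam s x u -> trajectory lam s y v ->
    (forall k, (k <= max_connection lam s)%N -> u k = v k) ->
  V x -> V y.
Proof.
move=> xu yv uv Vx; apply: contrapT => nVy.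
have x01 := V01 _ Vx.
have y01 : 0 <= y < 1 := interv_unit _ lam_gt0 lam_sum _ _ (yv 0%N).
have [b [c [f [f0 nin fl]]]] := boundary_between _ V x y V01 Vright Vx nVy.
move=> [[bE cE]|bP].
  rewrite bE cE in fl; move: fl.
  exact: (@outside_no_right_flank R T (discs lam) T01
    (iet_piecewise _ lam_gt0 lam_sum s) aper V V01 VT).
have b01 : 0 < b < 1.
  by move: bP; have [_|_] := lerP x y; lra.
have [n [nM nD]] := boundary_connection c f b f0 b01 nin fl.
suff : iter n T b \notin discs lam by rewrite nD.
have yu k : (k < n.+1)%N -> interv lam (u k) (iter k T y).
  by move=> kn; rewrite uv ?(leq_trans _ nM).
have xu' k (_ : (k < n.+1)%N) := xu k.
move: bP; have [_|_] := lerP x y => bP.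
  exact: (cylinder_interior lam lam_gt0 s u n.+1 x y b xu' yu bP).
exact: (cylinder_interior lam lam_gt0 s u n.+1 y x b yu xu' bP).
Qed.

(** A word counts as a word of [V] if it is read at some point of [V]; by
    [invariant_same_word] every point where it is read is then in [V].  The two
    ends of an edge are read at a point [z] and at [T z], which are both in [V] or
    both outside, so the words of [V] are a union of connected components. *)
Lemma invariant_connected :
    rauzy_connected (language lam s) (max_connection lam s).+1 ->
  forall x y, 0 <= x < 1 -> V y -> V x.
Proof.
set N := (max_connection lam s).+1 => conn x y x01 Vy.
pose Vword (w : N.-tuple 'I_r) :=
  exists z f, [/\ V z, trajectory lam s z f & w = mkseq f N :> seq 'I_r].
have VwordE z f (w : N.-tuple 'I_r) : trajectory lam s z f ->
    w = mkseq f N :> seq 'I_r -> Vword w <-> V z.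
  move=> zf wf; split=> [[z' [f' [Vz' z'f' wf']]]|Vz]; last by exists z, f.
  apply: (invariant_same_word z' z f' f) => // k kN.
  have : nth (f k) w k = nth (f k) w k by [].
  by rewrite {1}wf' wf !nth_mkseq.
have Vedge w w' : rauzy_edge (language lam s) w w' -> Vword w <-> Vword w'.
  move=> [a [b [v [wE w'E [z [u [z01 zu [m mE]]]]]]]].
  have sv : size (rcons v b) = N by rewrite -w'E size_tuple.
  have uf := trajectory_shift _ _ m zu.
  move: mE; rewrite [size _]/= sv; set f := fun k => u (m + k)%N => mE.
  have wf : w = mkseq f N :> seq 'I_r.
    by move: mE; rewrite -rcons_cons mkseqS wE => /rcons_inj[-> -> _].
  have w'f : w' = mkseq (fun k => f (1 + k)%N) N :> seq 'I_r.
    by move: mE; rewrite w'E mkseq_cons => -[_ ->].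
  rewrite (VwordE _ _ _ uf wf) (VwordE _ _ _ (trajectory_shift _ _ 1 uf) w'f).
  by rewrite /= VT //; apply: iter_unit.
have closedV : fingraph.closed (rauzy_adj (language lam s) (n:=N))
    [pred w | `[< Vword w >]].
  move=> w w' /orP[] /asboolP /Vedge E; apply/asboolP/asboolP; tauto.
have [u xu] := trajectory_ex _ lam_sum s x (fun n => iter_unit _ _ T01 n x x01).
have y01 := V01 _ Vy.
have [v yv] := trajectory_ex _ lam_sum s y (fun n => iter_unit _ _ T01 n y y01).
pose wx := word u N; pose wy := word v N.
have : connect (rauzy_adj (language lam s) (n:=N)) wy wx.
  by apply: conn; [exact: word_language yv | exact: word_language xu].
move=> /(fingraph.closed_connect closedV); rewrite !inE => VV.
apply/(VwordE x u wx) => //; apply/asboolP; rewrite -VV; apply/asboolP.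
by exists y, v.
Qed.

End InvariantSet.

(** If the orbit of [x] stays away from [y], the invariant set to consider is
    that of the points whose orbit enters a small interval [y, y + h[. *)
Lemma connected_dense_orbits :
    rauzy_connected (language lam s) (max_connection lam s).+1 ->
  forall x y e, 0 <= x < 1 -> 0 <= y < 1 -> 0 < e ->
    exists n, `|y - iter n T x| < e.
Proof.
move=> conn x y e x01 y01 e_gt0; apply: contrapT => far.
pose h := Num.min e (1 - y).
have h_gt0 : 0 < h by rewrite lt_min e_gt0; lra.
have [he h1] : h <= e /\ h <= 1 - y by rewrite !ge_min !lexx orbT.
pose V z := 0 <= z < 1 /\ exists n, y <= iter n T z < y + h.
suff [_ [n nP]] : V x by apply: far; exists n; rewrite ltr_norml; lra.
apply: (invariant_connected V _ _ _ conn x y) => //.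
- by move=> z [].
- move=> z z01; split=> [[_ [n nP]]|[_ [n nP]]].
    by split=> //; exists n.+1; rewrite iterSr.
  split; first exact: T01.
  (* A point of the interval itself has to come back to it. *)
  have [k k0 kP] : exists2 k, (0 < k)%N & y <= iter k T z < y + h.
    case: n nP => [/= zP|n nP]; last by exists n.+1.
    apply: (@recurrence R T (discs lam) T01
      (iet_piecewise _ lam_gt0 lam_sum s) (iet_inj _ _ lam_gt0 lam_sum)) => //.
      by case/andP: y01.
    lra.
  by exists k.-1; rewrite -iterSr prednK.
- move=> z [z01 [n nP]].
  have [u zu] := trajectory_ex _ lam_sum s z (fun n => iter_unit _ _ T01 n z z01).
  have [f f_gt0 fP] := cylinder_right _ lam_gt0 s z u n zu.
  exists (Num.min f (Num.min (1 - z) (y + h - iter n T z))) => [|t].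
    by rewrite !lt_min f_gt0; lra.
  rewrite !lt_min => tP; split; first by lra.
  have [|_ tn] := fP t; first by lra.
  by exists n; rewrite tn; lra.
- by split=> //; exists 0%N => /=; lra.
Qed.

End Exchange.
End IntervalExchange.

Theorem theorem5 (R : realType) (r : nat) (lam : 'I_r -> R) (s : 'S_r)
    (lam_gt0 : forall i : 'I_r, 0 < lam i)
    (lam_sum : \sum_(i < r) lam i = 1)
    (aperiodic : no_periodic_point (iet lam s)) :
  minimal (iet lam s) <->
  rauzy_connected (language lam s) (max_connection lam s).+1.
Proof.
split=> [dense|conn].
  apply: dense_orbits_connected => // x y e x01 y01 e_gt0.
  by apply: (proj1 (closure_orbit _ _ _ _ _ _)) e_gt0; apply: dense.
have aper x n : 0 <= x < 1 -> (0 < n)%N -> iter n (iet lam s) x <> x.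
  by move=> x01; apply: aperiodic.
move=> x x01 y y01; apply/closure_orbit => e e_gt0.
exact: connected_dense_orbits.
Qed.
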